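(* Let $-\infty \le a < b \le \infty$ and let $p : (a,b) \to \mathbb{R}$ be continuous on the open interval $(a,b)$, not necessarily continuous or bounded at its endpoints. If a nontrivial real solution $u$ on $(a,b)$ of $$u'' + p(x)\,u = 0$$ satisfies the boundary conditions $$\int_{a} \frac{dx}{u^2(x)} = \infty, \qquad \int^{b} \frac{dx}{u^2(x)} = \infty ,$$ then every real solution on $(a,b)$ of the same equation which is linearly independent of $u$ has a zero in $(a,b)$.
   Context: The notation $\int_a \frac{dx}{u^2(x)} = \infty$ means that the integral diverges at the endpoint $a$: for every $c \in (a,b)$, $\int_a^c \frac{dx}{u^2(x)} = \infty$. Similarly $\int^b \frac{dx}{u^2(x)} = \infty$ means that for every $c \in (a,b)$, $\int_c^b \frac{dx}{u^2(x)} = \infty$. The integrals of the nonnegative function $1/u^2$ (with $1/0 = \infty$) take values in $[0,\infty]$. Solutions are real-valued, twice differentiable functions on the open interval $(a,b)$; a zero in $(a,b)$ is a point of the open interval at which the function vanishes. *)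

(* Defs.v *)
From HB Require Import structures.
From mathcomp Require Import all_boot all_order all_algebra.
From mathcomp Require Import all_classical all_reals all_analysis.

Set Implicit Arguments.
Unset Strict Implicit.
Unset Printing Implicit Defensive.

Import Order.TTheory GRing.Theory Num.Theory.
Import numFieldNormedType.Exports.

Local Open Scope classical_set_scope.
Local Open Scope ring_scope.

(* The real points of the open interval (a, b), whose endpoints may be
   infinite. *)
Definition eoo (R : realType) (a b : \bar R) : set R :=
  [set x : R | (a < x%:E)%E /\ (x%:E < b)%E].

(* Functions on (a, b) are represented by total functions R -> R. Since (a, b)
   is open, derivatives at its points depend only on values in (a, b). *)
Definition is_solution (R : realType) (a b : \bar R) (p u : R -> R) : Prop :=
  forall x : R, eoo a b x ->
    [/\ derivable u x 1,
        derivable (derive1 u) x 1 &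
        derive1 (derive1 u) x + p x * u x = 0].

Definition nontrivial_on (R : realType) (a b : \bar R) (u : R -> R) : Prop :=
  exists2 x : R, eoo a b x & u x != 0.

Definition linearly_independent_on (R : realType) (a b : \bar R)
    (u v : R -> R) : Prop :=
  forall k l : R, (forall x : R, eoo a b x -> k * u x + l * v x = 0) ->
    k = 0 /\ l = 0.

(* Lebesgue integral with values in [0, +oo]; the inverse is the one of \bar R,
   for which 0^-1 = +oo. *)
Definition int_inv_sqr (R : realType) (a b : \bar R) (u : R -> R) : \bar R :=
  (\int[@lebesgue_measure R]_(x in eoo a b) ((u x ^+ 2)%:E)^-1)%E.

Definition diverges_at_left_end (R : realType) (a b : \bar R) (u : R -> R)
    : Prop :=
  forall c : R, eoo a b c -> int_inv_sqr a c%:E u = +oo%E.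

Definition diverges_at_right_end (R : realType) (a b : \bar R) (u : R -> R)
    : Prop :=
  forall c : R, eoo a b c -> int_inv_sqr c%:E b u = +oo%E.

(* Main.v *)
Require Import Defs.
From HB Require Import structures.
From mathcomp Require Import all_boot all_order all_algebra.
From mathcomp Require Import all_classical all_reals all_analysis.
From mathcomp Require Import measurable_realfun ring lra.

Set Implicit Arguments.
Unset Strict Implicit.
Unset Printing Implicit Defensive.

Import Order.TTheory GRing.Theory Num.Theory.
Import numFieldNormedType.Exports.

Local Open Scope classical_set_scope.
Local Open Scope ring_scope.

(** Suppose that a solution [v] independent of [u] had no zero.  The Wronskian
[w = u' v - u v'] is a constant, so [h = u / v] satisfies [h' = w / v^2]
([wronskian_cst], [is_derive_ratio]).  If [w = 0] then [u] is a multiple of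
[v], against independence.  Otherwise [g = w h] has the derivative
[w^2 / v^2 >= 0], hence is nondecreasing, and [- 1 / g] is a primitive of
[1 / u^2] wherever [u] does not vanish, since
[g' / g^2 = (w^2 / v^2) / (w^2 u^2 / v^2) = 1 / u^2].

Take a point [c] with [u c != 0], so that [g c != 0].  If [g c > 0], then
[g >= g c > 0] on [(c, b)], where [- 1 / g] therefore increases by at most
[1 / g c]: the integral of [1 / u^2] over [(c, b)] is finite.  If [g c < 0],
the same argument on [(a, c)] bounds the integral there by [- 1 / g c].
Either way one of the two divergence hypotheses fails.  The passage from
bounded increments of a primitive to a finite integral on an open interval
with possibly infinite endpoints is [eoo_integral_le]. *)

(** * Calculus on an open interval with extended real endpoints *)

Lemma eoo_le_trans (R : realType) (a b : \bar R) (s t x : R) :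
  eoo a b s -> eoo a b t -> s <= x <= t -> eoo a b x.
Proof.
move=> [as_ _] [_ tb] /andP[sx xt]; split.
  by rewrite (lt_le_trans as_)// lee_fin.
by rewrite (le_lt_trans _ tb)// lee_fin.
Qed.

Lemma eoo_derive_continuous (R : realType) (a b : \bar R) (F f : R -> R)
    (s t : R) :
  (forall x, eoo a b x -> is_derive x 1 F (f x)) ->
  eoo a b s -> eoo a b t -> {within `[s, t], continuous F}.
Proof.
move=> dF es et; apply: derivable_within_continuous => x.
by rewrite in_itv/= => /(eoo_le_trans es et)/dF[].
Qed.

Lemma eoo_MVT (R : realType) (a b : \bar R) (F f : R -> R) (s t : R) :
  (forall x, eoo a b x -> is_derive x 1 F (f x)) ->
  eoo a b s -> eoo a b t -> s <= t ->
  exists2 c, eoo a b c & F t - F s = f c * (t - s).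
Proof.
move=> dF es et st.
have dFst x : x \in `]s, t[ -> is_derive x 1 F (f x).
  rewrite in_itv/= => /andP[sx xt]; apply/dF/(eoo_le_trans es et).
  by rewrite !ltW.
have [c] := MVT_segment st dFst (eoo_derive_continuous dF es et).
by rewrite in_itv/= => /(eoo_le_trans es et) ec ->; exists c.
Qed.

Lemma eoo_derive0_cst (R : realType) (a b : \bar R) (F : R -> R) (s t : R) :
  (forall x, eoo a b x -> is_derive x 1 F 0) ->
  eoo a b s -> eoo a b t -> F s = F t.
Proof.
move=> dF; wlog st : s t / s <= t.
  by move=> H es et; case: (leP s t) => [|/ltW] ?; [|symmetry]; exact: H.
move=> es et; have [c _] := eoo_MVT (f := fun=> 0) dF es et st.
by rewrite mul0r => /eqP; rewrite subr_eq0 => /eqP.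
Qed.

(** Stated for a lower endpoint only: applied to [- b] it also provides a
sequence increasing to an upper endpoint [b].  The infinite endpoint needs its
own sequence, [- n] instead of [r + 1 / (n + 1)]. *)
Lemma lower_endpoint_seq (R : realType) (a : \bar R) : a != +oo%E ->
  exists s : nat -> R, [/\ nonincreasing_seq s, forall n, (a < (s n)%:E)%E &
    forall x : R, (a < x%:E)%E -> exists n, s n <= x].
Proof.
case: a => [r| //|] _.
- exists (fun n => r + n.+1%:R^-1); split.
  + by move=> m n mn; rewrite lerD2l lef_pV2 ?posrE// ler_nat.
  + by move=> n; rewrite lte_fin ltrDl.
  + move=> x; rewrite lte_fin => rx.
    exists (Num.bound (x - r)^-1); rewrite -lerBrDl.
    rewrite -[leRHS]invrK lef_pV2 ?posrE ?invr_gt0 ?subr_gt0//.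
    have := archi_boundP (x := (x - r)^-1).
    rewrite invr_ge0 subr_ge0 ltW// => /(_ isT)/ltW/le_trans; apply.
    by rewrite ler_nat.
- exists (fun n => - n%:R); split.
  + by move=> m n mn; rewrite lerN2 ler_nat.
  + by move=> n; exact: ltNyr.
  + move=> x _; exists (Num.bound `|x|).
    rewrite lerNl (le_trans (ler_norm _))// normrN ltW//.
    exact: archi_boundP.
Qed.

Lemma eoo_exhaustion (R : realType) (a b : \bar R) : (a < b)%E ->
  exists s t : nat -> R,
    nondecreasing_seq (fun n => `[s n, t n]%classic) /\
    eoo a b = \bigcup_n `[s n, t n]%classic.
Proof.
move=> ab.
have aNy : a != +oo%E by rewrite -ltey (lt_le_trans ab (leey b)).
have bNy : (- b != +oo)%E.
  by rewrite -ltey lteNl/= (le_lt_trans (leNye a) ab).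
have [s [smono sa sx]] := lower_endpoint_seq aNy.
have [t [tmono tb tx]] := lower_endpoint_seq bNy.
exists s, (fun n => - t n); split.
  move=> m n mn; apply/subsetPset => x /=; rewrite !in_itv/= => /andP[sm tm].
  rewrite (le_trans (smono _ _ mn) sm)/= (le_trans tm)// lerN2.
  exact: tmono.
apply/seteqP; split=> x.
  move=> [/sx[m mx] xb].
  have [n nx] : exists n, t n <= - x by apply: tx; rewrite EFinN lteN2.
  exists (maxn m n) => //=; rewrite in_itv/=; apply/andP; split.
    by rewrite (le_trans _ mx)// smono// leq_maxl.
  by rewrite lerNr (le_trans _ nx)// tmono// leq_maxr.
move=> [n _] /=; rewrite in_itv/= => /andP[sn tn]; split.
  by rewrite (lt_le_trans (sa n))// lee_fin.
by rewrite (@le_lt_trans _ _ (- t n)%:E) ?lee_fin// EFinN lteNl.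
Qed.

(** The fundamental theorem of calculus bounds the integral over every compact
subinterval by [M]; monotone convergence along an exhaustion by compact
intervals carries the bound to the open interval, so that no limit of the
primitive [F] at the endpoints is involved. *)
Lemma eoo_integral_le (R : realType) (a b : \bar R) (F f : R -> R) (M : R) :
  (a < b)%E -> 0 <= M ->
  (forall x, eoo a b x -> is_derive x 1 F (f x)) ->
  (forall x, eoo a b x -> {for x, continuous f}) ->
  (forall x, eoo a b x -> 0 <= f x) ->
  (forall s t, eoo a b s -> eoo a b t -> s <= t -> F t - F s <= M) ->
  (\int[@lebesgue_measure R]_(x in eoo a b) (f x)%:E <= M%:E)%E.
Proof.
move=> ab M0 dF cf f0 FM.
have [s [t [stmono eooE]]] := eoo_exhaustion ab.
have sub n : `[s n, t n] `<=` eoo a b by rewrite eooE => x ?; exists n.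
have cfn n : {within `[s n, t n], continuous f}.
  apply: continuous_in_subspaceT => x; rewrite inE => /sub; exact: cf.
have bound n : (\int[@lebesgue_measure R]_(x in `[s n, t n]) (f x)%:E <= M%:E)%E.
  (* The first intervals of the exhaustion may be empty or reduced to a point;
     their integral is 0, which [0 <= M] bounds. *)
  have [st|ts|<-] := ltgtP (s n) (t n); last 2 first.
  - by rewrite set_itv_ge ?bnd_simp -?ltNge// integral_set0 lee_fin.
  - by rewrite set_itv1 integral_set1 lee_fin.
  have es : eoo a b (s n) by apply: (sub n); rewrite /= in_itv/= lexx ltW.
  have et : eoo a b (t n) by apply: (sub n); rewrite /= in_itv/= lexx ltW.
  have eoc x : x \in `]s n, t n[ -> eoo a b x.
    by rewrite in_itv/= => /andP[? ?]; apply: (eoo_le_trans es et); rewrite !ltW.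
  have [_ cs ct] := (continuous_within_itvP F st).1
    (eoo_derive_continuous dF es et).
  rewrite (continuous_FTC2 (F := F) st (cfn n)).
  - by rewrite -EFinB lee_fin FM// ltW.
  - by split=> // x /eoc/dF[].
  - by move=> x /eoc/dF[_ dFx]; rewrite derive1E.
rewrite eooE.
have : (\int[@lebesgue_measure R]_(x in `[s n, t n]%classic) (f x)%:E @[n --> \oo] -->
    \int[@lebesgue_measure R]_(x in \bigcup_n `[s n, t n]%classic) (f x)%:E)%E.
  apply: ge0_nondecreasing_set_cvg_integral => //.
  - move=> n; apply/measurable_EFinP.
    by apply: subspace_continuous_measurable_fun => //; exact: cfn.
  - by move=> n x xn; rewrite lee_fin; exact/f0/(sub n).
by move/cvge_to_le; apply; exact: nearW.
Qed.

(** * The Wronskian and the ratio of two solutions *)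

Lemma solution_is_derive (R : realType) (a b : \bar R) (p u : R -> R) (x : R) :
  is_solution a b p u -> eoo a b x ->
  is_derive x 1 u (derive1 u x) /\ is_derive x 1 (derive1 u) (- (p x * u x)).
Proof.
move=> hu /hu[du ddu uE]; split.
  by apply: DeriveDef => //; rewrite derive1E.
apply: DeriveDef => //; rewrite -derive1E.
by apply/eqP; rewrite -addr_eq0 uE.
Qed.

Definition wronskian (R : realType) (u v : R -> R) (x : R) : R :=
  derive1 u x * v x - u x * derive1 v x.

(** The derivative is [u'' v - u v''], in which the two terms [- p u v]
cancel. *)
Lemma wronskian_cst (R : realType) (a b : \bar R) (p u v : R -> R) (s t : R) :
  is_solution a b p u -> is_solution a b p v ->
  eoo a b s -> eoo a b t -> wronskian u v s = wronskian u v t.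
Proof.
move=> hu hv; apply: eoo_derive0_cst => x ex.
have [du ddu] := solution_is_derive hu ex.
have [dv ddv] := solution_is_derive hv ex.
have := is_deriveB (is_deriveM ddu dv) (is_deriveM du ddv).
by move/is_derive_eq; apply; rewrite /GRing.scale/=; ring.
Qed.

Lemma is_derive_ratio (R : realType) (u v : R -> R) (du dv x : R) :
  v x != 0 -> is_derive x 1 u du -> is_derive x 1 v dv ->
  is_derive x 1 (fun y => u y / v y) ((du * v x - u x * dv) / v x ^+ 2).
Proof.
move=> vx0 hu hv.
have := is_deriveM hu (is_deriveV vx0 hv).
by move/is_derive_eq; apply; rewrite /GRing.scale/=; field.
Qed.

(** * Finiteness of the integral, and the zeros *)

(** Nonvanishing of [u] turns the extended real inverse in [int_inv_sqr] into
the real one, which is continuous. *)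
Lemma int_inv_sqr_lty (R : realType) (a b : \bar R) (u G : R -> R) (M : R) :
  (a < b)%E -> 0 <= M ->
  (forall x, eoo a b x -> u x != 0) ->
  (forall x, eoo a b x -> {for x, continuous u}) ->
  (forall x, eoo a b x -> is_derive x 1 G (u x ^- 2)) ->
  (forall s t, eoo a b s -> eoo a b t -> s <= t -> G t - G s <= M) ->
  (int_inv_sqr a b u < +oo)%E.
Proof.
move=> ab M0 u0 cu dG GM; rewrite /int_inv_sqr.
under eq_integral.
  move=> x /[1!inE] /u0 ux0; rewrite inver expf_eq0 (negbTE ux0)/=; over.
apply: (@le_lt_trans _ _ M%:E); last exact: ltry.
apply: (eoo_integral_le (F := G)) => // x ex.
  apply: cvgV; first by rewrite expf_neq0 ?u0.
  have := continuous_comp (cu x ex) (@exprn_continuous _ 2 (u x)).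
  exact.
by rewrite invr_ge0 sqr_ge0.
Qed.

Theorem mainTheorem2 (R : realType) (a b : \bar R) (hab : (a < b)%E)
    (p : R -> R)
    (hp : forall x : R, eoo a b x -> {for x, continuous p})
    (u : R -> R)
    (hu : is_solution a b p u)
    (hu_nontrivial : nontrivial_on a b u)
    (hua : diverges_at_left_end a b u)
    (hub : diverges_at_right_end a b u) :
  forall v : R -> R, is_solution a b p v -> linearly_independent_on a b u v ->
    exists2 x : R, eoo a b x & v x = 0.
Proof.
move=> v hv uv_indep; apply: contrapT => v_nz.
have v0 x : eoo a b x -> v x != 0.
  by move=> ex; apply/eqP => vx0; apply: v_nz; exists x.
have [c ec uc0] := hu_nontrivial.
set w := wronskian u v c.
have dh x : eoo a b x -> is_derive x 1 (fun y => u y / v y) (w / v x ^+ 2).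
  move=> ex; rewrite /w (wronskian_cst hu hv ec ex).
  have [du _] := solution_is_derive hu ex.
  have [dv _] := solution_is_derive hv ex.
  exact: is_derive_ratio (v0 _ ex) du dv.
have w0 : w != 0.
  apply/eqP => w0.
  have [|/eqP] := uv_indep 1 (- (u c / v c)); last by rewrite oner_eq0.
  have dh0 x : eoo a b x -> is_derive x 1 (fun y => u y / v y) 0.
    by move=> /dh; rewrite w0 mul0r.
  move=> x ex; have -> : u c / v c = u x / v x := eoo_derive0_cst dh0 ec ex.
  by have := v0 _ ex => vx0; field.
pose g x := w * (u x / v x).
have dg x : eoo a b x -> is_derive x 1 g (w ^+ 2 / v x ^+ 2).
  move=> ex; have := is_deriveZ w (dh _ ex).
  by move/is_derive_eq; apply; rewrite /GRing.scale/=; ring.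
have g_homo s t : eoo a b s -> eoo a b t -> s <= t -> g s <= g t.
  move=> es et st; rewrite -subr_ge0.
  have [z _ ->] := eoo_MVT dg es et st.
  by rewrite mulr_ge0 ?subr_ge0// divr_ge0 ?sqr_ge0.
have gu x : g x != 0 -> u x != 0.
  by apply: contraNneq => ux0; rewrite /g ux0 mul0r mulr0.
(* [- 1 / g], which is [- v / (w u)], is a primitive of [1 / u^2]. *)
have dG x : eoo a b x -> g x != 0 ->
    is_derive x 1 (fun y => - (g y)^-1) (u x ^- 2).
  move=> ex gx0.
  have := is_deriveN (is_deriveV gx0 (dg _ ex)).
  move/is_derive_eq; apply; rewrite /GRing.scale/= /g.
  have := v0 _ ex; have := gu _ gx0 => ux0 vx0.
  by field; rewrite w0 ux0 vx0.
have cu x : eoo a b x -> {for x, continuous u}.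
  by case/hu => du _ _; apply/differentiable_continuous/derivable1_diffP.
have [ac cb] := ec.
have gc0 : g c != 0 by rewrite !mulf_neq0 ?invr_eq0 ?v0.
have [gcn|gcp|/eqP] := ltgtP (g c) 0; last by rewrite (negbTE gc0).
(* To the left of [c], [g] stays below [g c < 0]. *)
- have sub x : eoo a c%:E x -> eoo a b x.
    by move=> [ax xc]; split=> //; exact: lt_trans cb.
  have gneg x : eoo a c%:E x -> g x < 0.
    move=> ex; apply: le_lt_trans gcn; apply: g_homo => //; first exact: sub.
    by case: ex => _; rewrite lte_fin => /ltW.
  have : (int_inv_sqr a c%:E u < +oo)%E; last by rewrite hua.
  apply: (@int_inv_sqr_lty _ _ _ _ (fun y => - (g y)^-1) (- (g c)^-1)) => //.
  + by rewrite oppr_ge0 invr_le0 ltW.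
  + by move=> x /gneg gx; apply/gu; rewrite lt_eqF.
  + by move=> x /sub; exact: cu.
  + by move=> x ex; apply: dG; [exact: sub|rewrite lt_eqF// gneg].
  + move=> s t es et st.
    have gt_le : g t <= g c.
      apply: g_homo; [exact: sub|by []|].
      by case: et => _; rewrite lte_fin => /ltW.
    have : (g c)^-1 <= (g t)^-1 by rewrite lef_nV2 ?negrE// gneg.
    have : (g s)^-1 < 0 by rewrite invr_lt0 gneg.
    lra.
(* To the right of [c], [g] stays above [g c > 0]. *)
- have sub x : eoo c%:E b x -> eoo a b x.
    by move=> [cx xb]; split=> //; exact: lt_trans cx.
  have gc_le x : eoo c%:E b x -> g c <= g x.
    move=> ex; apply: g_homo => //; first exact: sub.
    by case: ex; rewrite lte_fin => /ltW.
  have gpos x : eoo c%:E b x -> 0 < g x by move=> /gc_le; exact: lt_le_trans.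
  have : (int_inv_sqr c%:E b u < +oo)%E; last by rewrite hub.
  apply: (@int_inv_sqr_lty _ _ _ _ (fun y => - (g y)^-1) (g c)^-1) => //.
  + by rewrite invr_ge0 ltW.
  + by move=> x /gpos gx; apply/gu; rewrite gt_eqF.
  + by move=> x /sub; exact: cu.
  + by move=> x ex; apply: dG; [exact: sub|rewrite gt_eqF// gpos].
  + move=> s t es et st.
    have : (g s)^-1 <= (g c)^-1 by rewrite lef_pV2 ?posrE ?gc_le// gpos.
    have : 0 < (g t)^-1 by rewrite invr_gt0 gpos.
    lra.
Qed.
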